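(* Let $X=\ell_q$ (complex) with $2<q<\infty$. A typical $T\in(\mathcal{P}_1(X),\mathrm{SOT})$ has no eigenvalue.
   Context: $X=\ell_q=\ell_q(\mathbb{Z}_+)$ is equipped with its canonical basis. A vector is positive if all its coordinates are $\ge0$; a bounded operator $T$ on $X$ is positive if it maps positive vectors to positive vectors. $\mathcal{P}_1(X)$ is the set of bounded positive operators with $\|T\|\le1$. $\mathrm{SOT}$: $T_i\to T$ iff $\|T_ix-Tx\|\to0$ for every $x\in X$. ''A typical $T\in(\mathcal{P}_1(X),\mathrm{SOT})$ has property (P)'' means that the set of $T\in\mathcal{P}_1(X)$ with (P) is comeager, i.e. contains a dense $G_\delta$ subset of $(\mathcal{P}_1(X),\mathrm{SOT})$. *)

(* Defs.v *)
From HB Require Import structures.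
From mathcomp Require Import all_boot all_order all_algebra.
From mathcomp Require Import complex.
From mathcomp Require Import all_classical all_reals all_analysis.
From mathcomp Require Import borel_hierarchy.

Set Implicit Arguments.
Unset Strict Implicit.
Unset Printing Implicit Defensive.

Import Order.TTheory GRing.Theory Num.Theory.
Import ComplexField.Normc.
Import numFieldNormedType.Exports.

Local Open Scope classical_set_scope.
Local Open Scope ring_scope.
Local Open Scope complex_scope.

Section lqenorm.
Context {R : realType}.
Implicit Types (q : R) (x y : nat -> R[i]).

(* [normc z] is the modulus of z as an element of R, while [`|z|] is the same
   real number seen in R[i]. *)
Definition lqenorm q x : \bar R :=
  'N[@counting _ R]_q%:E [(fun n => (normc (x n))%:E)].

Lemma lqenormE q x : 0 < q ->
  lqenorm q x = ((\sum_(0 <= n <oo) (normc (x n) `^ q)%:E) `^ q^-1)%E.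
Proof.
move=> q0; rewrite /lqenorm Lnorm_counting//; congr (_ `^ _)%E.
by apply: eq_eseriesr => n _ /=; rewrite ger0_norm//; case: (x n) => a b /=.
Qed.

Let normc_ge0 (z : R[i]) : 0 <= normc z.
Proof. by case: z => a b; exact: sqrtr_ge0. Qed.

Lemma lqenorm_ge0 q x : (0 <= lqenorm q x)%E.
Proof. exact: Lnorm_ge0. Qed.

Lemma lqenorm0 q : 0 < q -> lqenorm q (fun=> 0) = 0%E.
Proof.
move=> q0; rewrite lqenormE// eseries0 ?poweR0r ?invr_eq0 ?gt_eqF// => n _ _.
by rewrite normc0 powR0// gt_eqF.
Qed.

Lemma lqenormZ q (l : R[i]) x : 0 < q ->
  lqenorm q (fun n => l * x n) = ((normc l)%:E * lqenorm q x)%E.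
Proof.
move=> q0; rewrite !lqenormE//.
under eq_eseriesr do rewrite normcM powRM// EFinM.
rewrite nneseriesZl; last by move=> n _; rewrite lee_fin powR_ge0.
rewrite poweRM ?lee_fin ?powR_ge0//; last first.
  by apply: nneseries_ge0 => n _ _; rewrite lee_fin powR_ge0.
by rewrite poweR_EFin -powRrM mulfV ?gt_eqF// powRr1.
Qed.

Lemma lqenormD q x y : 1 <= q ->
  (lqenorm q (fun n => (x n + y n)%R) <= lqenorm q x + lqenorm q y)%E.
Proof.
move=> q1; have q0 : 0 < q by exact: lt_le_trans q1.
apply: (@le_trans _ _ ('N[@counting _ R]_q%:E
    [EFin \o ((fun n => normc (x n)) \+ (fun n => normc (y n)))%R])%E); last first.
  exact: (@minkowski_EFin _ nat R).
rewrite /lqenorm !Lnorm_counting//; apply: gt0_ler_poweR.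
- by rewrite invr_ge0 ltW.
- by rewrite in_itv/= leey andbT nneseries_ge0// => n _ _; exact: poweR_ge0.
- by rewrite in_itv/= leey andbT nneseries_ge0// => n _ _; exact: poweR_ge0.
apply: lee_nneseries => [n _ _|n _]; first exact: poweR_ge0.
rewrite /= lee_fin ge0_ler_powR ?nnegrE//; first exact: ltW.
rewrite !ger0_norm ?addr_ge0//; exact: le_normcD.
Qed.

Lemma lqenorm_eq0 q x : 0 < q -> lqenorm q x = 0%E -> forall n, x n = 0.
Proof.
move=> q0; rewrite lqenormE// => /poweR_eq0_eq0.
have s0 n : (0 <= (normc (x n) `^ q)%:E)%E by rewrite lee_fin powR_ge0.
move=> /(_ (nneseries_ge0 (fun n _ _ => s0 n))) sum0 n.
have : ((normc (x n) `^ q)%:E <= 0)%E.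
  rewrite -sum0 (@nneseries_split _ _ 0 n.+1)// add0n big_nat_recr//= -addeA.
  rewrite addeCA leeDl// adde_ge0 ?sume_ge0//.
  by apply: nneseries_ge0 => *; exact: s0.
rewrite lee_fin => xq0; apply: eq0_normc; apply: (@powR_eq0_eq0 _ _ q).
by apply/eqP; rewrite eq_le xq0 powR_ge0.
Qed.

End lqenorm.

Section lq_space.
Context {R : realType} (q : R) (q1 : 1 <= q).

Let q0 : 0 < q. Proof. exact: lt_le_trans q1. Qed.

(* The scalars R[i]^o make sequences a module over R[i]; R[i] itself carries
   the R-module structure. The argument q1 only serves structure inference. *)
Definition lq_pred of 1 <= q : {pred nat -> R[i]^o} :=
  mem [set x | (lqenorm q x < +oo)%E].

Lemma lq_pred_submod_closed : submod_closed (lq_pred q1).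
Proof.
split => [|l x y].
  by apply/mem_set; rewrite /= lqenorm0.
move=> /set_mem /= lx /set_mem /= ly; apply/mem_set => /=.
apply: le_lt_trans (lqenormD (fun n => l * x n) y q1) _.
rewrite lte_add_pinfty// lqenormZ// lte_mul_pinfty ?lee_fin//.
by case: (l) => a b; exact: sqrtr_ge0.
Qed.

HB.instance Definition _ :=
  GRing.isSubmodClosed.Build _ _ (lq_pred q1) lq_pred_submod_closed.

Definition lq : Type := {x : nat -> R[i]^o | x \in lq_pred q1}.

HB.instance Definition _ := SubChoice.on lq.
HB.instance Definition _ := [SubChoice_isSubLmodule of lq by <:].

Definition coord (x : lq) (n : nat) : R[i] := val x n.

Definition lqnorm (x : lq) : R := fine (lqenorm q (coord x)).

Lemma lqnormE x : (lqnorm x)%:E = lqenorm q (coord x).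
Proof.
rewrite /lqnorm fineK// ge0_fin_numE ?lqenorm_ge0//.
exact: (set_mem (valP x)).
Qed.

Lemma lqnorm_ge0 x : 0 <= lqnorm x.
Proof. by rewrite fine_ge0// lqenorm_ge0. Qed.

Lemma ler_lqnormD x y : (lqnorm (x + y))%:C <= (lqnorm x)%:C + (lqnorm y)%:C.
Proof.
rewrite -rmorphD/= lecR -lee_fin EFinD !lqnormE.
exact: lqenormD.
Qed.

Lemma lqnormZ (l : R[i]) x : (lqnorm (l *: x))%:C = `|l| * (lqnorm x)%:C.
Proof.
rewrite [`|l|](_ : _ = (normc l)%:C)// -rmorphM/=; congr (_%:C).
apply/EFin_inj; rewrite EFinM !lqnormE; exact: lqenormZ.
Qed.

Lemma lqnorm_eq0 x : (lqnorm x)%:C = 0 -> x = 0.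
Proof.
move=> [nx0]; apply/val_inj/funext => n.
by apply: (lqenorm_eq0 q0); rewrite -lqnormE nx0.
Qed.

HB.instance Definition _ := Lmodule_isNormed.Build R[i] lq
  ler_lqnormD lqnormZ lqnorm_eq0.

Lemma lq_normE (x : lq) : `|x| = (lqnorm x)%:C.
Proof. by []. Qed.

End lq_space.

Lemma cvg_initial (S : choiceType) (T : topologicalType) (f : S -> T)
    (F : set_system S) (s : S) : Filter F ->
  F --> (s : initial_topology f) <-> f @ F --> f s.
Proof.
move=> FF; split => [Fs|Ffs].
  by apply: (cvg_comp _ _ Fs); exact: initial_continuous.
move=> A [B [[C oC <-] Cs CA]]; apply: filterS CA _; apply: Ffs.
exact: open_nbhs_nbhs.
Qed.

Section typical_positive_contractions.
Context {R : realType} (q : R) (q1 : 1 <= q).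
Local Notation X := (lq q1).
Implicit Type T : X -> X.

Definition bounded_operator T : Prop :=
  linear T /\ exists M : R, forall x, lqnorm (T x) <= M * lqnorm x.

Definition opnorm T : R :=
  sup [set lqnorm (T x) | x in [set x | lqnorm x <= 1]].

(* In R[i], [0 <= z] says that z is real and nonnegative. *)
Definition positive_vector (x : X) : Prop := forall n, 0 <= coord x n.

Definition positive_operator T : Prop :=
  forall x, positive_vector x -> positive_vector (T x).

(* As a type, P1 carries the subspace topology of the topology of pointwise
   norm convergence on X -> X, that is, SOT; see [cvg_SOT]. *)
Definition P1 : set {ptws X -> X} :=
  [set T | [/\ bounded_operator T, positive_operator T & opnorm T <= 1]].

Definition operator (T : P1) : X -> X := \val T.

Lemma cvg_SOT (F : set_system P1) (T : P1) : Filter F ->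
  F --> T <->
  forall x, lqnorm (operator T x - operator S x) @[S --> F] --> (0 : R).
Proof.
move=> FF.
apply: iff_trans (@cvg_initial _ {ptws X -> X} set_val F T FF) _.
apply: iff_trans (@cvg_sup _ _ _ _ _ _) _; split => FT x.
  have /cvgrPdist_lt h : operator S x @[S --> F] --> operator T x.
    exact/(@cvg_initial _ X (fun f : X -> X => f x) (set_val @ F)
      (\val T))/FT.
  apply/cvgr0Pnorm_lt => e e0.
  have e0' : 0 < e%:C by rewrite ltcR.
  apply: filterS (h _ e0') => S /=; rewrite lq_normE ltcR.
  by rewrite ger0_norm// lqnorm_ge0.
apply/(@cvg_initial _ X (fun f : X -> X => f x) (set_val @ F) (\val T)).
apply/(@cvgrPdist_lt _ X _ F _ (fun S => operator S x)) => e e0.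
have er : e = (complex.Re e)%:C.
  by case: e e0 => a b /=; rewrite ltcE/= => /andP[/eqP->].
have /cvgr0Pnorm_lt h := FT x.
rewrite er ltcR in e0; apply: filterS (h _ e0) => S /=.
by rewrite er lq_normE ltcR/= ger0_norm// lqnorm_ge0.
Qed.

Definition comeager (Y : topologicalType) (A : set Y) : Prop :=
  exists G : set Y, [/\ Gdelta G, dense G & G `<=` A].

Definition typical (P : (X -> X) -> Prop) : Prop :=
  comeager [set T : P1 | P (operator T)].

Definition is_eigenvalue T (l : R[i]) : Prop :=
  exists2 x : X, x <> 0 & T x = l *: x.

End typical_positive_contractions.

Lemma gt2_ge1 {R : realType} (q : R) : 2 < q -> 1 <= q.
Proof. by move=> /ltW; apply: le_trans; rewrite ler1n. Qed.

(* Main.v *)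
Require Import Defs.
From mathcomp Require Import all_boot all_order all_algebra.
From mathcomp Require Import complex.
From mathcomp Require Import all_classical all_reals all_analysis.
From mathcomp Require Import ring lra.

Set Implicit Arguments.
Unset Strict Implicit.
Unset Printing Implicit Defensive.

Import Order.TTheory GRing.Theory Num.Theory.
Import ComplexField.Normc.
Import numFieldNormedType.Exports.
Import Defs.

Local Open Scope classical_set_scope.
Local Open Scope ring_scope.
Local Open Scope complex_scope.

(** For a positive contraction T, say that a positive unit vector v norms row k
    when |T v| = 1 and (T v)_k > 0. If S is a positive contraction close to T at
    v, and z is a positive vector disjoint from v, then
      |S (v + t z)|^q <= 1 + t^q |z|^q,
    whereas a nonzero coordinate (S z)_k would raise the norm of S v by a term of
    order t (norming_row_bound). As q > 1, letting t tend to 0 shows that (S z)_k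
    is small, uniformly in z. Hence a row that is normed by a finitely supported
    vector converges uniformly on bounded sets when S tends to T in SOT
    (norming_row_cvg): in such rows SOT controls also the adjoint operators.

    Consider now a perturbed shift T: an operator that acts as the right shift by
    N places on the coordinates beyond N, and as an arbitrary finite block on the
    first N coordinates together with e_N, where the rows N, ..., 2N contain a
    small multiple of the first N coordinates and a multiple of the coordinate N
    (perturbed_shift). All its rows from N on are normed by finitely supported
    vectors. If S is close to T and S x = l x with |x| <= M, then |l| <= 1 for
    x nonzero, and these rows give
    |x_j| <= |x_(j+N)| + small for j > N. Along the progression j, j+N, j+2N, ...
    the coordinates would thus be about |x_j| at least, so a bound on |x| makes
    x_j small; the rows 2N and N, ..., 2N - 1 then do the same for x_N and for
    the first N coordinates (vanishing_all). So near T no operator has an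
    eigenvector x with |x| <= n and some |x_k| >= 1/(n+1), k <= n.

    Perturbed shifts are dense (perturbed_shift_approx): compress T0 to the first
    N coordinates, add the shift part and the entries in the rows N, ..., 2N, and
    divide the finite block by its norm, which tends to 1. The norm of the block
    is attained by compactness at a positive vector v, and the same first order
    argument shows that the coordinate N of v is not 0, so that v norms all the
    rows N, ..., 2N (model_max_last).

    The interiors of the sets of operators with no eigenvector x such that
    |x| <= n and |x_k| >= 1/(n+1) for some k <= n therefore contain all perturbed
    shifts; their intersection is a dense G_delta set of operators without
    eigenvalue. *)

(** * Powers and moduli *)

Section powers.
Context {R : realType}.
Implicit Types a b q t : R.

Lemma powRVK q a : 0 < q -> 0 <= a -> (a `^ q^-1) `^ q = a.
Proof. by move=> q0 a0; rewrite -powRrM mulVf ?gt_eqF// powRr1. Qed.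

Lemma ler_powR_base q a b : 0 < q -> 0 <= a -> 0 <= b ->
  (a `^ q <= b `^ q) = (a <= b).
Proof.
move=> q0 a0 b0; apply/idP/idP => [|ab]; last first.
  by apply: ge0_ler_powR => //; rewrite ?nnegrE ?ltW.
apply: contraTT; rewrite -!ltNge => ba.
by apply: gt0_ltr_powR => //; rewrite nnegrE.
Qed.

Lemma ltr_powR_base q a b : 0 < q -> 0 <= a -> 0 <= b ->
  (a `^ q < b `^ q) = (a < b).
Proof. by move=> q0 a0 b0; rewrite !ltNge ler_powR_base. Qed.

Lemma powR_split q a : q != 0 -> 0 <= a -> a `^ q = a * a `^ (q - 1).
Proof.
move=> q0; rewrite le_eqVlt => /predU1P[<-|a0]; first by rewrite powR0// mul0r.
rewrite -[in LHS](subrKC 1 q) [in LHS]powRD; first by rewrite powRr1 ?ltW.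
by rewrite (gt_eqF a0) implybT.
Qed.

Lemma powR_superadd q a b : 1 <= q -> 0 <= a -> 0 <= b ->
  a `^ q + a `^ (q - 1) * b <= (a + b) `^ q.
Proof.
move=> q1 a0 b0; have qn0 : q != 0 by rewrite gt_eqF// (lt_le_trans _ q1).
rewrite (powR_split qn0 a0) (powR_split qn0 (addr_ge0 a0 b0)).
rewrite [X in _ + X]mulrC -mulrDl; apply: ler_wpM2l; first exact: addr_ge0.
by apply: ge0_ler_powR; rewrite ?nnegrE ?subr_ge0 ?addr_ge0 ?lerDl.
Qed.

End powers.

Section modulus.
Context {R : realType}.
Implicit Types z : R[i].

Lemma normc_ge0 z : 0 <= normc z.
Proof. by case: z => a b; exact: sqrtr_ge0. Qed.

Lemma normc_real (r : R) : normc r%:C = `|r|.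
Proof. by rewrite /normc /= expr0n addr0 sqrtr_sqr. Qed.

Lemma ge0_normc z : 0 <= z -> z = (normc z)%:C.
Proof.
case: z => a b; rewrite lecE/= => /andP[/eqP -> a0].
by rewrite expr0n/= addr0 sqrtr_sqr ger0_norm.
Qed.

Lemma ge0_realP z : 0 <= z -> exists2 r : R, 0 <= r & z = r%:C.
Proof. by move=> z0; exists (normc z); [exact: normc_ge0|exact: ge0_normc]. Qed.

Lemma normcB z w : normc (z - w) = normc (w - z).
Proof. by rewrite -normcN opprB. Qed.

Lemma ler_normcB z w : normc z <= normc (z - w) + normc w.
Proof. by rewrite -{1}[z](subrK w); exact: le_normcD. Qed.

End modulus.

(** * The norm and the lattice structure of the sequence space *)

#[local] Hint Extern 0 (is_true (@Order.le _ _ _ (lqnorm _))) =>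
  exact: lqnorm_ge0 : core.
#[local] Hint Extern 0 (is_true (@Order.le _ _ _ (normc _))) =>
  exact: normc_ge0 : core.

Section lq_basics.
Context {R : realType} {q : R} {q1 : 1 <= q}.
Local Notation X := (lq q1).
Implicit Types (x y z : X) (f : nat -> R[i]) (D : pred nat).

Lemma lq_exp_gt0 : 0 < q. Proof. exact: lt_le_trans q1. Qed.
Local Notation q0 := lq_exp_gt0.
#[local] Hint Resolve lq_exp_gt0 : core.

Lemma coordP x y : (forall n, coord x n = coord y n) -> x = y.
Proof. by move=> xy; apply/val_inj/funext. Qed.

Lemma coord0 n : coord (0 : X) n = 0. Proof. by []. Qed.
Lemma coordD x y n : coord (x + y) n = coord x n + coord y n. Proof. by []. Qed.
Lemma coordN x n : coord (- x) n = - coord x n. Proof. by []. Qed.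
Lemma coordB x y n : coord (x - y) n = coord x n - coord y n. Proof. by []. Qed.
Lemma coordZ l x n : coord (l *: x) n = l * coord x n. Proof. by []. Qed.

Lemma coord_sum I (r : seq I) (P : pred I) (F : I -> X) n :
  coord (\sum_(i <- r | P i) F i) n = \sum_(i <- r | P i) coord (F i) n.
Proof. by elim/big_rec2 : _ => // i y x _ <-. Qed.

Lemma lqnorm_powE x :
  (lqnorm x `^ q)%:E = (\sum_(0 <= n <oo) (normc (coord x n) `^ q)%:E)%E.
Proof.
rewrite -poweR_EFin lqnormE lqenormE// -poweRrM mulVf ?gt_eqF// poweRe1//.
by apply: nneseries_ge0 => n _ _; rewrite lee_fin powR_ge0.
Qed.

Lemma lqnorm_partial x K :
  \sum_(0 <= n < K) normc (coord x n) `^ q <= lqnorm x `^ q.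
Proof.
rewrite -lee_fin lqnorm_powE -sumEFin.
by apply: nneseries_lim_ge => n _ _; rewrite lee_fin powR_ge0.
Qed.

Lemma eseries_partial_le f C :
  (forall K, \sum_(0 <= n < K) normc (f n) `^ q <= C) ->
  (\sum_(0 <= n <oo) (normc (f n) `^ q)%:E <= C%:E)%E.
Proof.
move=> fC; apply: lime_le.
  by apply: is_cvg_nneseries => n _ _; rewrite lee_fin powR_ge0.
by near=> K; rewrite sumEFin lee_fin; exact: fC.
Unshelve. all: by end_near. Qed.

Lemma lqnorm_pow_le x C :
  (forall K, \sum_(0 <= n < K) normc (coord x n) `^ q <= C) ->
  lqnorm x `^ q <= C.
Proof. by move=> xC; rewrite -lee_fin lqnorm_powE; exact: eseries_partial_le. Qed.

(** Sequences that are not summable are sent to 0, so that operators can be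
    given by a formula for the coordinates. *)
Definition lq_of f : X := insubd (0 : X) f.

Lemma coord_lq_of f C :
  (forall K, \sum_(0 <= n < K) normc (f n) `^ q <= C) -> coord (lq_of f) =1 f.
Proof.
move=> fC n; rewrite /coord /lq_of insubdK//; apply/mem_set => /=.
rewrite lqenormE//; apply: poweR_lty.
exact: le_lt_trans (eseries_partial_le fC) (ltry _).
Qed.

Lemma coord_lq_of_dom f x : (forall n, normc (f n) <= normc (coord x n)) ->
  coord (lq_of f) =1 f.
Proof.
move=> fx; apply: (coord_lq_of (C := lqnorm x `^ q)) => K.
apply: le_trans (lqnorm_partial x K).
by apply: ler_sum => n _; rewrite ler_powR_base ?fx.
Qed.

Lemma ler_lqnorm x y : (forall n, normc (coord x n) <= normc (coord y n)) ->
  lqnorm x <= lqnorm y.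
Proof.
move=> xy; rewrite -(ler_powR_base q0)//; apply: lqnorm_pow_le => K.
apply: le_trans (lqnorm_partial y K).
by apply: ler_sum => n _; rewrite ler_powR_base ?xy.
Qed.

Lemma lqnorm_triangle x y : lqnorm (x + y) <= lqnorm x + lqnorm y.
Proof. by have := ler_lqnormD x y; rewrite -rmorphD/= lecR. Qed.

Lemma lqnorm_scale l x : lqnorm (l *: x) = normc l * lqnorm x.
Proof.
have := lqnormZ l x.
by rewrite (_ : `|l| = (normc l)%:C)// -rmorphM => /(congr1 (@complex.Re R)).
Qed.

Lemma lqnorm_opp x : lqnorm (- x) = lqnorm x.
Proof. by rewrite -scaleN1r lqnorm_scale normcN normc1 mul1r. Qed.

Lemma lqnorm_distC x y : lqnorm (x - y) = lqnorm (y - x).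
Proof. by rewrite -lqnorm_opp opprB. Qed.

Lemma lqnorm_zero : lqnorm (0 : X) = 0.
Proof. by rewrite -(scale0r 0) lqnorm_scale normc0 mul0r. Qed.

Lemma lqnorm_gt0 x : x <> 0 -> 0 < lqnorm x.
Proof.
move=> x0; rewrite lt_neqAle lqnorm_ge0 andbT; apply/eqP => nx0.
by apply: x0; apply: lqnorm_eq0; rewrite -nx0.
Qed.

Lemma lqnormB_ge x y : lqnorm x - lqnorm y <= lqnorm (x - y).
Proof.
by rewrite lerBlDr -{1}[x](subrK y); exact: lqnorm_triangle.
Qed.

Lemma lqnorm_coord x n : normc (coord x n) <= lqnorm x.
Proof.
rewrite -(ler_powR_base q0)//; apply: le_trans (lqnorm_partial x n.+1).
by rewrite big_nat_recr//= lerDr sumr_ge0// => *; exact: powR_ge0.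
Qed.

Definition disjoint_lq x y := forall n, coord x n = 0 \/ coord y n = 0.

Lemma lqnormD_disjoint x y : disjoint_lq x y ->
  lqnorm (x + y) `^ q = lqnorm x `^ q + lqnorm y `^ q.
Proof.
move=> xy; apply: EFin_inj; rewrite EFinD !lqnorm_powE -nneseriesD.
- apply: eq_eseriesr => n _; rewrite coordD -EFinD; congr (_%:E).
  by case: (xy n) => ->; rewrite ?addr0 ?add0r normc0 powR0 ?gt_eqF// ?addr0 ?add0r.
- by move=> *; rewrite lee_fin powR_ge0.
- by move=> *; rewrite lee_fin powR_ge0.
Qed.

(** Adding positive vectors gains in norm, in each coordinate, a term of first
    order in the increment. *)
Lemma lqnormD_positive x y k : positive_vector x -> positive_vector y ->
  lqnorm x `^ q + normc (coord x k) `^ (q - 1) * normc (coord y k)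
    <= lqnorm (x + y) `^ q.
Proof.
move=> x0 y0; rewrite -lerBrDr; apply: lqnorm_pow_le => K; rewrite lerBrDr.
apply: le_trans (lqnorm_partial (x + y) (maxn K k.+1)).
apply: (@le_trans _ _ (\sum_(0 <= n < maxn K k.+1) (normc (coord x n) `^ q +
    if n == k then normc (coord x k) `^ (q - 1) * normc (coord y k) else 0))).
  rewrite big_split/= lerD//.
    rewrite [leRHS](big_cat_nat (n := K))//= ?leq_maxl// lerDl sumr_ge0// => *.
    exact: powR_ge0.
  rewrite -big_mkcond/= -big_filter.
  rewrite filter_pred1_uniq ?iota_uniq ?big_seq1//.
  by rewrite mem_index_iota leq_maxr.
apply: ler_sum => n _; rewrite coordD.
have [a a0 xa] := ge0_realP (x0 n); have [b b0 yb] := ge0_realP (y0 n).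
rewrite xa yb -rmorphD !normc_real !ger0_norm ?addr_ge0//.
apply: le_trans (powR_superadd q1 a0 b0); rewrite lerD2l.
case: eqP => [<-|_]; first by rewrite xa yb !normc_real !ger0_norm.
by rewrite mulr_ge0// powR_ge0.
Qed.

(** The band projection attached to D in the Banach lattice. *)
Definition restr D x : X := lq_of (fun n => if D n then coord x n else 0).

Lemma coord_restr D x n : coord (restr D x) n = if D n then coord x n else 0.
Proof.
apply: (@coord_lq_of_dom _ x) => m.
by case: ifP => // _; rewrite normc0.
Qed.

Lemma lqnorm_restr_split D x :
  lqnorm x `^ q = lqnorm (restr D x) `^ q + lqnorm (restr (predC D) x) `^ q.
Proof.
rewrite -lqnormD_disjoint; last first.
  by move=> n; rewrite !coord_restr /=; case: (D n); [right|left].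
congr (lqnorm _ `^ _); apply: coordP => n; rewrite coordD !coord_restr /=.
by case: (D n); rewrite ?addr0 ?add0r.
Qed.

Lemma lqnorm_restr D x : lqnorm (restr D x) <= lqnorm x.
Proof.
apply: ler_lqnorm => n; rewrite coord_restr; case: ifP => // _.
by rewrite normc0 normc_ge0.
Qed.

Lemma restr_linear D : linear (restr D).
Proof.
move=> l x y; apply: coordP => n; rewrite coordD coordZ !coord_restr coordD coordZ.
by case: ifP => // _; rewrite mulr0 addr0.
Qed.

Lemma restr_positive D : positive_operator (restr D).
Proof. by move=> x x0 n; rewrite coord_restr; case: ifP => // _; exact: x0. Qed.

Lemma restrB_tail N x :
  x - restr (fun n => n < N)%N x = restr (fun n => N <= n)%N x.
Proof.
apply: coordP => n; rewrite coordB !coord_restr.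
by case: ltnP => _; rewrite ?subrr ?subr0.
Qed.

Lemma restr_tail_small x e : 0 < e ->
  \forall N \near \oo, lqnorm (restr (fun n => N <= n)%N x) < e.
Proof.
move=> e0.
have tailE N : (\sum_(N <= n <oo) (normc (coord x n) `^ q)%:E)%E =
    (lqnorm (restr (fun n => N <= n)%N x) `^ q)%:E.
  rewrite lqnorm_powE [RHS](@nneseries_split _ _ 0 N) ?add0n; last first.
    by move=> *; rewrite lee_fin powR_ge0.
  rewrite big_nat big1 ?add0e => [|n /andP[_ nN]]; last first.
    by rewrite coord_restr /= (leqNgt N n) nN normc0 powR0 ?gt_eqF.
  rewrite eseries_cond [RHS]eseries_cond; apply: eq_eseriesr => n /andP[_ Nn].
  by rewrite coord_restr Nn.
have : (\sum_(N <= n <oo) (normc (coord x n) `^ q)%:E)%E @[N --> \oo] --> 0%E.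
  apply: nneseries_tail_cvg; first by rewrite -lqnorm_powE ltry.
  by move=> *; rewrite lee_fin powR_ge0.
have eq0 : 0 < e `^ q by rewrite powR_gt0.
under eq_fun do rewrite tailE.
move=> /fine_cvgP[_] /cvgr0Pnorm_lt /(_ _ eq0); apply: filterS => N /=.
by rewrite ger0_norm ?powR_ge0// ltr_powR_base// ltW.
Unshelve. all: by end_near. Qed.

Definition rshift N x : X :=
  lq_of (fun n => if (n < N)%N then 0 else coord x (n - N)).

Lemma rshift_partial N x K : \sum_(0 <= n < K)
    normc (if (n < N)%N then 0 else coord x (n - N)) `^ q <= lqnorm x `^ q.
Proof.
apply: le_trans (lqnorm_partial x K).
have [KN|/ltnW NK] := leqP K N.
  rewrite big_nat big1 ?sumr_ge0// => [*|n /andP[_ nK]]; first exact: powR_ge0.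
  by rewrite (leq_trans nK KN) normc0 powR0// gt_eqF.
rewrite (big_cat_nat (n := N))//= big_nat big1 ?add0r => [|n /andP[_ ->]]; last first.
  by rewrite normc0 powR0// gt_eqF.
rewrite -{1}[N]add0n big_addn (big_cat_nat (n := K - N) (p := K)) ?leq_subr//=.
rewrite (@eq_bigr _ _ _ _ _ _ _ (fun n => normc (coord x n) `^ q)) => [|n _].
  by rewrite lerDl sumr_ge0// => *; exact: powR_ge0.
by rewrite ltnNge leq_addl/= addnK.
Qed.

Lemma coord_rshift N x n :
  coord (rshift N x) n = if (n < N)%N then 0 else coord x (n - N).
Proof. exact: (coord_lq_of (rshift_partial N x)). Qed.

Lemma lqnorm_rshift N x : lqnorm (rshift N x) <= lqnorm x.
Proof.
rewrite -(ler_powR_base q0)//; apply: lqnorm_pow_le => K.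
under eq_bigr do rewrite coord_rshift.
exact: rshift_partial.
Qed.

Lemma rshift_linear N : linear (rshift N).
Proof.
move=> l x y; apply: coordP => n; rewrite coordD coordZ !coord_rshift coordD coordZ.
by case: ifP => // _; rewrite mulr0 addr0.
Qed.

Lemma rshift_positive N : positive_operator (rshift N).
Proof. by move=> x x0 n; rewrite coord_rshift; case: ifP => // _; exact: x0. Qed.

Definition basis k : X := lq_of (fun n => (n == k)%:R).

Lemma basis_partial k K :
  \sum_(0 <= n < K) normc ((n == k)%:R : R[i]) `^ q <= 1.
Proof.
rewrite (@eq_bigr _ _ _ _ _ _ _ (fun n => if n == k then 1 else 0)) => [|n _].
  rewrite -big_mkcond/= -big_filter.
  have [kK|kK] := boolP (k \in index_iota 0 K).
    by rewrite filter_pred1_uniq ?iota_uniq// big_seq1.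
  rewrite (_ : [seq i <- _ | _] = [::]) ?big_nil//.
  by apply/eqP; rewrite -[_ == _]negbK -has_filter has_pred1 (negbTE kK).
by case: eqP => _; rewrite ?normc1 ?powR1// normc0 powR0// gt_eqF.
Qed.

Lemma coord_basis k n : coord (basis k) n = (n == k)%:R.
Proof. exact: (coord_lq_of (basis_partial k)). Qed.

Lemma lqnorm_basis k : lqnorm (basis k) = 1.
Proof.
apply/eqP; rewrite eq_le; apply/andP; split.
  rewrite -(ler_powR_base q0)// powR1; apply: lqnorm_pow_le => K.
  under eq_bigr do rewrite coord_basis.
  exact: basis_partial.
by have := lqnorm_coord (basis k) k; rewrite coord_basis eqxx normc1.
Qed.

Lemma basis_positive k : positive_vector (basis k).
Proof. by move=> n; rewrite coord_basis; case: eqP. Qed.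

Lemma restr_sum K x :
  restr (fun n => n < K)%N x = \sum_(k < K) coord x k *: basis k.
Proof.
apply: coordP => n; rewrite coord_restr coord_sum.
under eq_bigr do rewrite coordZ coord_basis.
case: ifP => nK; last first.
  rewrite big1// => k _; case: eqP => [nk|]; last by rewrite mulr0.
  by rewrite nk ltn_ord in nK.
rewrite (bigD1 (Ordinal nK))//= eqxx mulr1 big1 ?addr0// => k.
by rewrite -val_eqE/= eq_sym => /negbTE ->; rewrite mulr0.
Qed.

Definition abs_lq x : X := lq_of (fun n => (normc (coord x n))%:C).

Lemma coord_abs x n : coord (abs_lq x) n = (normc (coord x n))%:C.
Proof.
by apply: (@coord_lq_of_dom _ x) => m; rewrite normc_real ger0_norm.
Qed.

Lemma abs_positive x : positive_vector (abs_lq x).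
Proof. by move=> n; rewrite coord_abs lecR. Qed.

Lemma lqnorm_abs x : lqnorm (abs_lq x) = lqnorm x.
Proof.
by apply/eqP; rewrite eq_le; apply/andP; split; apply: ler_lqnorm => n;
  rewrite coord_abs normc_real ger0_norm.
Qed.

End lq_basics.

(** * Positive contractions *)

Section positive_contractions.
Context {R : realType} {q : R} {q1 : 1 <= q}.
Local Notation X := (lq q1).
Local Notation q0 := (@lq_exp_gt0 R q q1).
Implicit Types (x y z v : X) (T S : X -> X).
Let exp_gt0 : 0 < q := lq_exp_gt0 (q1 := q1).
#[local] Hint Resolve exp_gt0 : core.

Section linear_operators.
Context (T : X -> X) (linT : linear T).

Lemma opD x y : T (x + y) = T x + T y.
Proof. by have := linT 1 x y; rewrite !scale1r. Qed.

Lemma op0 : T 0 = 0.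
Proof. by apply: (addrI (T 0)); rewrite -opD !addr0. Qed.

Lemma opZ l x : T (l *: x) = l *: T x.
Proof. by have := linT l x 0; rewrite !addr0 op0 addr0. Qed.

Lemma opB x y : T (x - y) = T x - T y.
Proof. by rewrite -scaleN1r opD opZ scaleN1r. Qed.

Lemma op_sum I (r : seq I) (P : pred I) (F : I -> X) :
  T (\sum_(i <- r | P i) F i) = \sum_(i <- r | P i) T (F i).
Proof. by elim/big_rec2 : _ => [|i y x _ <-]; [exact: op0|exact: opD]. Qed.

End linear_operators.

Definition pcontraction T :=
  [/\ linear T, positive_operator T & forall x, lqnorm (T x) <= lqnorm x].

(** Homogeneity turns the bound on the supremum over the unit ball into a bound
    at every vector. *)
Lemma P1P (T : {ptws X -> X}) : P1 T <-> pcontraction T.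
Proof.
split => [[[linT [M TM]] posT nT]|[linT posT nT]]; last first.
  split => //; first by split => //; exists 1 => x; rewrite mul1r.
  apply: ge_sup.
    by exists (lqnorm (T 0)), 0 => //=; rewrite lqnorm_zero.
  by move=> _ [x /= x1 <-]; exact: le_trans (nT x) x1.
split => // x; have [->|/eqP x0] := eqVneq x 0.
  by rewrite (op0 linT) !lqnorm_zero.
have nx0 := lqnorm_gt0 x0.
have nxV : normc (lqnorm x)%:C^-1 = (lqnorm x)^-1.
  by rewrite normcV normc_real ger0_norm.
have : lqnorm (T ((lqnorm x)%:C^-1 *: x)) <= 1.
  apply: le_trans nT; apply: ub_le_sup; last first.
    by exists ((lqnorm x)%:C^-1 *: x) => //=; rewrite lqnorm_scale nxV mulVf ?gt_eqF.
  exists `|M| => _ [y /= y1 <-]; apply: (le_trans (TM y)).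
  apply: (le_trans (ler_norm _)); rewrite normrM -[leRHS]mulr1 ler_wpM2l//.
  by rewrite ger0_norm.
by rewrite (opZ linT) lqnorm_scale nxV mulrC ler_pdivrMr// mul1r.
Qed.

Lemma positive_vectorD x y : positive_vector x -> positive_vector y ->
  positive_vector (x + y).
Proof. by move=> x0 y0 n; rewrite coordD addr_ge0 ?x0 ?y0. Qed.

Lemma positive_vectorZ (r : R) x : 0 <= r -> positive_vector x ->
  positive_vector (r%:C *: x).
Proof. by move=> r0 x0 n; rewrite coordZ mulr_ge0 ?x0// lecR. Qed.

Definition re_lq x : X := lq_of (fun n => (complex.Re (coord x n))%:C).

Lemma normc_ge_normRe (w : R[i]) : `|complex.Re w| <= normc w.
Proof. by have := normc_ge_Re w; rewrite lecR. Qed.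

Lemma coord_re x n : coord (re_lq x) n = (complex.Re (coord x n))%:C.
Proof.
apply: (@coord_lq_of_dom _ _ _ _ x) => m.
by rewrite normc_real normc_ge_normRe.
Qed.

Lemma unimodular_rotation (w : R[i]) :
  exists2 u : R[i], normc u = 1 & u * w = (normc w)%:C.
Proof.
have [->|w0] := eqVneq w 0; first by exists 1; rewrite ?normc1// mulr0 normc0.
exists ((normc w)%:C / w); last by rewrite divfK.
rewrite normcM normcV normc_real ger0_norm// divff//.
by apply: contraNneq w0 => /eq0_normc ->.
Qed.

Section positive_operators.
Context (T : X -> X) (linT : linear T) (posT : positive_operator T).

Lemma op_monotone x y : (forall n, coord x n <= coord y n) ->
  forall n, coord (T x) n <= coord (T y) n.
Proof.
move=> xy n; rewrite -subr_ge0 -coordB -(opB linT); apply: posT => m.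
by rewrite coordB subr_ge0.
Qed.

(** A real vector is the difference of the positive vectors |x| and |x| - x. *)
Lemma op_real x : (forall n, complex.Im (coord x n) = 0) ->
  forall n, complex.Im (coord (T x) n) = 0.
Proof.
move=> xr n.
have absB0 : positive_vector (abs_lq x - x).
  move=> m; rewrite coordB coord_abs subr_ge0 lecE/= xr eqxx/=.
  exact: le_trans (ler_norm _) (normc_ge_normRe _).
have -> : x = abs_lq x - (abs_lq x - x) by rewrite opprB addrC subrK.
rewrite (opB linT) coordB.
have [a _ ->] := ge0_realP (posT (abs_positive x) n).
by have [b _ ->] := ge0_realP (posT absB0 n); rewrite -rmorphB.
Qed.

(** Rotating x makes the coordinate of T x real, and then only the real part
    of x, which lies below |x|, contributes to it. *)
Lemma op_abs x n : normc (coord (T x) n) <= normc (coord (T (abs_lq x)) n).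
Proof.
have [u u1 uw] := unimodular_rotation (coord (T x) n).
pose y := u *: x; pose im := y - re_lq y.
have Ty : coord (T y) n = (normc (coord (T x) n))%:C by rewrite (opZ linT) coordZ.
have re_im : complex.Im (coord (T (re_lq y)) n) = 0.
  by apply: op_real => m; rewrite coord_re.
have im_re : complex.Re (coord (T im) n) = 0.
  have -> : im = 'i%C *: ((- 'i%C) *: im).
    by rewrite scalerA mulrN -expr2 sqr_i opprK scale1r.
  rewrite (opZ linT) coordZ.
  have := op_real (x := - 'i%C *: im).
  rewrite /= => /(_ _ n); case: (coord _ n) => a b /= ->; last first.
    move=> m; rewrite coordZ coordB coord_re.
    by case: (coord y m) => c d /=; ring.
  by rewrite !mul0r mulr0 subr0.
have {}Ty : (normc (coord (T x) n))%:C = coord (T (re_lq y)) n.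
  have : coord (T y) n = coord (T (re_lq y)) n + coord (T im) n.
    by rewrite -coordD -(opD linT) /im subrKC.
  rewrite Ty => /(congr1 (@complex.Re R)).
  rewrite [in RHS]raddfD/= im_re addr0 => ->.
  by case: (coord _ n) re_im => a b /= ->.
have : coord (T (re_lq y)) n <= coord (T (abs_lq x)) n.
  apply: op_monotone => m; rewrite coord_re coord_abs lecR.
  apply: le_trans (ler_norm _) (le_trans (normc_ge_normRe _) _).
  by rewrite coordZ normcM u1 mul1r.
by rewrite -Ty {1}(ge0_normc (posT (abs_positive x) n)) lecR.
Qed.

Lemma lqnorm_op_abs x : lqnorm (T x) <= lqnorm (T (abs_lq x)).
Proof. by apply: ler_lqnorm => n; exact: op_abs. Qed.

End positive_operators.

(** The perturbation v + t z of a norming vector v gains only t^q in norm, while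
    a positive operator would turn a nonzero coordinate of T z in a row where
    T v is nonzero into a gain of order t. *)
Lemma norming_row_bound T v z k (t : R) : pcontraction T ->
  positive_vector v -> positive_vector z -> disjoint_lq v z ->
  lqnorm v <= 1 -> lqnorm z <= 1 -> 0 <= t ->
  1 - t `^ q <= lqnorm (T v) `^ q ->
  normc (coord (T v) k) `^ (q - 1) * (t * normc (coord (T z) k)) <= t `^ q *+ 2.
Proof.
move=> [linT posT nT] v0 z0 vz v1 z1 t0 Tv.
have tz0 := positive_vectorZ t0 z0.
have := lqnormD_positive k (posT _ v0) (posT _ tz0).
rewrite {1}(opZ linT) coordZ normcM normc_real ger0_norm// -(opD linT).
have : lqnorm (T (v + t%:C *: z)) `^ q <= 1 + t `^ q.
  apply: (@le_trans _ _ (lqnorm (v + t%:C *: z) `^ q)).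
    by rewrite ler_powR_base.
  rewrite lqnormD_disjoint => [|n]; last first.
    by rewrite coordZ; case: (vz n) => ->; [left|right; rewrite mulr0].
  rewrite lqnorm_scale normc_real ger0_norm// lerD//.
    by apply: (@le_trans _ _ (1 `^ q)); [rewrite ler_powR_base|rewrite powR1].
  by rewrite ler_powR_base ?mulr_ge0// ler_piMr.
lra.
Qed.

End positive_contractions.

(** * Convergence of norming rows *)

Section norming_rows.
Context {R : realType} {q : R} {q1 : 1 <= q} (hq : 1 < q).
Local Notation X := (lq q1).
Local Notation P1X := (@P1 R q q1).
Implicit Types (x y z v : X) (S T : P1X).
Let exp_gt0 : 0 < q := lq_exp_gt0 (q1 := q1).
#[local] Hint Resolve exp_gt0 : core.

Lemma operator_contraction T : pcontraction (operator T).
Proof. by case: T => f fP; have /P1P := set_mem fP. Qed.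

Lemma SOT_near T x (e : R) : 0 < e ->
  \forall S \near T, lqnorm (operator T x - operator S x) < e.
Proof.
move=> e0; have TT : nbhs T --> T by [].
have /cvgr0Pnorm_lt/(_ e e0) := (cvg_SOT T (nbhs_filter T)).1 TT x.
by apply: (@filterS _ _ (nbhs_filter T)) => S /=; rewrite ger0_norm.
Qed.

Definition finitely_supported x := exists K, forall n, (K <= n)%N -> coord x n = 0.

Definition norms_row (T : X -> X) k v :=
  [/\ positive_vector v, lqnorm v = 1, lqnorm (T v) = 1 & coord (T v) k != 0].

(** Only the tail of a row can escape to infinity in an approximation, and
    norming_row_bound, applied to the approximants with t small, prevents it: v
    remains almost norming for them, and the coordinate of S v stays away
    from 0. *)
Lemma norming_row_tail T v k (M e : R) : norms_row (operator T) k v -> 0 < e ->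
  \forall S \near T, forall z, disjoint_lq v z -> lqnorm z <= M ->
    normc (coord (operator S z) k) <= e.
Proof.
move=> [v0 v1 Tv1 Tvk] e0.
wlog M0 : M / 0 < M => [hwlog|].
  have := hwlog (`|M| + 1); rewrite ltr_wpDl// => /(_ isT).
  apply: filterS => S h z vz zM; apply: h => //; apply: (le_trans zM).
  by rewrite (le_trans (ler_norm _))// lerDl.
have a0 : 0 < normc (coord (operator T v) k).
  rewrite lt_neqAle normc_ge0 andbT eq_sym; apply: contraNneq Tvk => /eq0_normc ->.
  by [].
set a := normc _ in a0; pose b := (a / 2) `^ (q - 1).
have b0 : 0 < b by rewrite powR_gt0// divr_gt0.
have r0 : 0 < q - 1 by rewrite subr_gt0.
(* t and s = t^(q-1) are chosen so that 2 t^q M / (t b) = e. *)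
pose s := e * b / (M *+ 2).
have s0 : 0 < s by rewrite divr_gt0 ?mulr_gt0// mulrn_wgt0.
pose t := s `^ (q - 1)^-1.
have t0 : 0 < t by rewrite powR_gt0.
have tE : t `^ q = t * s.
  by rewrite powR_split ?gt_eqF ?ltW// powRVK ?ltW.
pose w := Num.max 0 (1 - t `^ q) `^ q^-1.
have w1 : w < 1.
  rewrite -(ltr_powR_base exp_gt0) ?powR_ge0// powRVK ?le_max ?lexx// powR1.
  by rewrite gt_max ltr01/= gtrBl powR_gt0.
have a20 : 0 < a / 2 by rewrite divr_gt0.
have w10 : 0 < 1 - w by rewrite subr_gt0.
near=> S => z vz zM.
have [linS posS nS] := operator_contraction S.
have near_a : lqnorm (operator T v - operator S v) < a / 2.
  by near: S; exact: SOT_near.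
have near_w : lqnorm (operator T v - operator S v) < 1 - w.
  by near: S; exact: SOT_near.
have Sv : 1 - t `^ q <= lqnorm (operator S v) `^ q.
  apply: (@le_trans _ _ (w `^ q)).
    by rewrite powRVK ?le_max ?lexx ?orbT.
  rewrite ler_powR_base ?powR_ge0//.
  by have := lqnormB_ge (operator T v) (operator S v); rewrite Tv1; lra.
have Svk : a / 2 <= normc (coord (operator S v) k).
  have := ler_normcB (coord (operator T v) k) (coord (operator S v) k).
  rewrite -coordB -/a.
  by have := lqnorm_coord (operator T v - operator S v) k; lra.
pose u := M^-1%:C *: abs_lq z.
have u0 : positive_vector u.
  by apply: positive_vectorZ; [rewrite invr_ge0 ltW|exact: abs_positive].
have vu : disjoint_lq v u.
  move=> n; case: (vz n) => vzn; [by left|right].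
  by rewrite coordZ coord_abs vzn normc0 mulr0.
have u1 : lqnorm u <= 1.
  rewrite lqnorm_scale lqnorm_abs normc_real gtr0_norm ?invr_gt0//.
  by rewrite mulrC ler_pdivrMr// mul1r.
have := norming_row_bound k (operator_contraction S) v0 u0 vu _ u1 (ltW t0) Sv.
rewrite v1 => /(_ (lexx _)) bound.
apply: (le_trans (op_abs linS posS z k)).
have -> : abs_lq z = M%:C *: u.
  by rewrite scalerA -rmorphM mulfV ?gt_eqF// scale1r.
rewrite (opZ linS) coordZ normcM normc_real (ger0_norm (ltW M0)).
set c := normc (coord (operator S u) k) in bound *.
have bc : b * (t * c) <= t `^ q *+ 2.
  apply: le_trans bound; apply: ler_wpM2r.
    by apply: mulr_ge0; [exact: ltW|exact: normc_ge0].
  by apply: ge0_ler_powR; rewrite ?nnegrE// ltW.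
have {}bc : b * c <= s *+ 2.
  by rewrite -(ler_pM2l t0) mulrCA (le_trans bc)// tE mulrnAr.
rewrite -(ler_pM2l b0) mulrCA -ler_pdivlMl// (le_trans bc)//.
rewrite le_eqVlt; apply/orP; left; apply/eqP; rewrite /s; field.
by rewrite gt_eqF.
Unshelve. all: by end_near. Qed.

(** A row in which the operator attains its norm at a finitely supported vector
    converges, along any approximation in SOT, uniformly on bounded sets. *)
Lemma norming_row_cvg T v k (M e : R) : finitely_supported v ->
  norms_row (operator T) k v -> 0 < e ->
  \forall S \near T, forall x, lqnorm x <= M ->
    normc (coord (operator S x) k - coord (operator T x) k) <= e.
Proof.
move=> [K vK] Tvk e0.
have e30 : 0 < e / 3 by rewrite divr_gt0.
have tail := norming_row_tail M Tvk e30.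
have tailT := nbhs_singleton tail.
wlog M0 : M tail tailT / 0 < M => [hwlog|].
  have e31 := norming_row_tail (`|M| + 1) Tvk e30.
  have := hwlog (`|M| + 1) e31 (nbhs_singleton e31).
  rewrite ltr_wpDl// => /(_ isT).
  apply: filterS => S h z zM; apply: h => //; apply: (le_trans zM).
  by rewrite (le_trans (ler_norm _))// lerDl.
pose d := e / 3 / (M * K.+1%:R).
have d0 : 0 < d by rewrite divr_gt0 ?mulr_gt0.
near=> S => x xM.
have [linS posS nS] := operator_contraction S.
have [linT posT nT] := operator_contraction T.
have head_near : forall j : 'I_K,
    lqnorm (operator T (basis j) - operator S (basis j)) < d.
  by near: S; apply: filter_forall => j; exact: SOT_near.
have tailS : forall z, disjoint_lq v z -> lqnorm z <= M ->
    normc (coord (operator S z) k) <= e / 3.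
  by near: S; exact: tail.
pose h := restr (fun n => n < K)%N x; pose z := restr (fun n => K <= n)%N x.
have xE : x = h + z by rewrite /h /z -restrB_tail subrKC.
have vz : disjoint_lq v z.
  move=> n; rewrite coord_restr; case: leqP => Kn; [left; exact: vK|by right].
have zM : lqnorm z <= M by apply: le_trans xM; exact: lqnorm_restr.
have headle : normc (coord (operator S h) k - coord (operator T h) k) <= e / 3.
  rewrite -coordB; apply: le_trans (lqnorm_coord _ _) _.
  rewrite /h restr_sum (op_sum linS) (op_sum linT) -sumrB.
  apply: (@le_trans _ _ (\sum_(j < K) M * d)).
    elim/big_ind2 : _ => [|a b c f ab cf|j _]; first by rewrite lqnorm_zero.
      by apply: le_trans (lqnorm_triangle _ _) _; exact: lerD.
    rewrite (opZ linS) (opZ linT) -scalerBr lqnorm_scale lqnorm_distC.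
    by apply: ler_pM => //; [exact: le_trans (lqnorm_coord _ _) xM|exact: ltW].
  rewrite sumr_const card_ord -[leLHS]mulr_natr /d.
  rewrite (_ : M * _ * K%:R = e / 3 * (K%:R / K.+1%:R)); last first.
    by field; rewrite nat1r pnatr_eq0/= (gt_eqF M0).
  by apply: ler_piMr; [exact: ltW|rewrite ler_pdivrMr// mul1r ler_nat].
rewrite xE (opD linS) (opD linT) !coordD opprD addrACA.
apply: le_trans (le_normcD _ _) _.
have := le_normcD (coord (operator S z) k) (- coord (operator T z) k).
rewrite normcN; have := tailS _ vz zM; have := tailT _ vz zM; lra.
Unshelve. all: by end_near. Qed.

End norming_rows.

(** * Norm attainment in finite dimension *)

Section norm_attained.
Context {R : realType} {q : R} {q1 : 1 <= q}.
Local Notation X := (lq q1).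
Let exp_gt0 : 0 < q := lq_exp_gt0 (q1 := q1).
#[local] Hint Resolve exp_gt0 : core.

Definition of_row n (u : 'rV[R]_n) : X := \sum_(j < n) (u 0 j)%:C *: basis j.

Lemma coord_of_row n (u : 'rV[R]_n) k (kn : (k < n)%N) :
  coord (of_row u) k = (u 0 (Ordinal kn))%:C.
Proof.
rewrite coord_sum (bigD1 (Ordinal kn))//= coordZ coord_basis eqxx mulr1.
rewrite big1 ?addr0// => j; rewrite -val_eqE/= coordZ coord_basis eq_sym.
by move=> /negbTE ->; rewrite mulr0.
Qed.

Lemma coord_of_row_out n (u : 'rV[R]_n) k : (n <= k)%N -> coord (of_row u) k = 0.
Proof.
move=> nk; rewrite coord_sum big1// => j _; rewrite coordZ coord_basis.
by case: eqP => [kj|]; [move: (ltn_ord j); rewrite -kj ltnNge nk|rewrite mulr0].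
Qed.

Lemma of_rowB n (u w : 'rV[R]_n) : of_row u - of_row w = of_row (u - w).
Proof.
rewrite /of_row -sumrB; apply: eq_bigr => j _.
by rewrite -scalerBl -rmorphB !mxE.
Qed.

Lemma of_rowZ n (r : R) (u : 'rV[R]_n) : of_row (r *: u) = r%:C *: of_row u.
Proof.
by rewrite scaler_sumr; apply: eq_bigr => j _; rewrite scalerA -rmorphM mxE.
Qed.

Lemma lqnorm_of_row n (u : 'rV[R]_n) : lqnorm (of_row u) <= n%:R * `|u|.
Proof.
apply: (@le_trans _ _ (\sum_(j < n) `|u|)); last first.
  by rewrite sumr_const card_ord mulr_natl.
rewrite /of_row; elim/big_ind2 : _ => [|a b c f ab cf|j _]; first by rewrite lqnorm_zero.
  by apply: le_trans (lqnorm_triangle _ _) _; exact: lerD.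
rewrite lqnorm_scale lqnorm_basis mulr1 normc_real.
by rewrite [leRHS]mx_normrE; apply: (le_bigmax _ (fun i => `|u i.1 i.2|) (0, j)).
Qed.

Lemma row_operator_continuous n (B : X -> X) (C : R) : linear B ->
  (forall x, lqnorm (B x) <= C * lqnorm x) ->
  continuous (fun u : 'rV[R]_n => lqnorm (B (of_row u))).
Proof.
move=> linB BC u.
have lip w : `|lqnorm (B (of_row u)) - lqnorm (B (of_row w))| <=
    (`|C| * n%:R + 1) * `|u - w|.
  apply: (@le_trans _ _ (lqnorm (B (of_row (u - w))))).
    rewrite -of_rowB (opB linB) ler_norml lerNl opprB.
    by apply/andP; split; [rewrite lqnorm_distC|]; exact: lqnormB_ge.
  apply: le_trans (BC _) _; rewrite mulrDl mul1r ler_wpDr//.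
  apply: (@le_trans _ _ (`|C| * lqnorm (of_row (u - w)))).
    by apply: ler_wpM2r => //; exact: ler_norm.
  by rewrite -mulrA; apply: ler_wpM2l => //; exact: lqnorm_of_row.
have C0 : 0 < `|C| * n%:R + 1 by rewrite ltr_wpDl// mulr_ge0.
apply/(@cvgrPdist_lt _ _ _ (nbhs u) (nbhs_filter u)) => e e0.
have e'0 : 0 < (`|C| * n%:R + 1)^-1 * e by rewrite mulr_gt0// invr_gt0.
have uu : nbhs u --> u by [].
have := (@cvgrPdist_lt _ _ _ (nbhs u) (nbhs_filter u) id u).1 uu _ e'0.
apply: (@filterS _ _ (nbhs_filter u)) => w uw.
by apply: le_lt_trans (lip w) _; rewrite -ltr_pdivlMl.
Qed.

(** On the finite-dimensional space of vectors supported in the first n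
    coordinates a positive operator attains its norm by compactness, and, since
    |B x| <= B |x|, it attains it at a positive vector. *)
Lemma norm_attained n (B : X -> X) (C : R) : linear B -> positive_operator B ->
  (forall x, lqnorm (B x) <= C * lqnorm x) ->
  exists v, [/\ positive_vector v, lqnorm v = 1,
    forall k, (n < k)%N -> coord v k = 0 &
    forall x, (forall k, (n < k)%N -> coord x k = 0) ->
      lqnorm (B x) <= lqnorm (B v) * lqnorm x].
Proof.
move=> linB posB BC.
pose A := [set u : 'rV[R]_n.+1 | (forall j, 0 <= u 0 j) /\ lqnorm (of_row u) = 1].
have pos_row (u : 'rV[R]_n.+1) : (forall j, 0 <= u 0 j) -> positive_vector (of_row u).
  move=> u0 k; have [kn|nk] := ltnP k n.+1; last by rewrite coord_of_row_out.
  by rewrite (coord_of_row _ kn) lecR.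
have A0 : A !=set0.
  exists (delta_mx 0 0); split => [j|]; first by rewrite mxE ler0n.
  have -> : of_row (delta_mx 0 0 : 'rV[R]_n.+1) = basis 0%N.
    rewrite /of_row big_ord_recl/= !mxE/= scale1r big1 ?addr0// => j _.
    by rewrite mxE/= scale0r.
  exact: lqnorm_basis.
have Acompact : compact A.
  apply: bounded_closed_compact.
    exists 1; split => // M M1 u [u0 u1] /=.
    rewrite [leLHS]mx_normrE; apply: bigmax_le => [|[i j] _ /=].
      exact: le_trans ler01 (ltW M1).
    rewrite ord1 (le_trans _ (ltW M1))// -u1 -normc_real.
    have := lqnorm_coord (of_row u) j.
    by rewrite (coord_of_row u (ltn_ord j)) (_ : Ordinal _ = j)//; exact: val_inj.
  have -> : A = (\bigcap_(j in setT) [set u : 'rV[R]_n.+1 | 0 <= u 0 j]) `&`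
      [set u | lqnorm (of_row u) = 1].
    by apply/seteqP; split => u [u0 u1]; split => // j *; exact: u0.
  apply: closedI.
    apply: closed_bigI => j _.
    apply: (@preimage_closed _ _ (fun u : 'rV[R]_n.+1 => u 0 j) [set r | 0 <= r]).
      by move=> u _; exact: coord_continuous.
    exact: closed_ge.
  apply: (@preimage_closed _ _ (fun u : 'rV[R]_n.+1 => lqnorm (of_row u)) [set 1]).
    move=> u _; apply: (@row_operator_continuous _ id 1) => // x.
    by rewrite mul1r.
  exact: closed_eq.
have [|v /set_mem[v0 v1] vmax] := EVT_max_rV A0 Acompact
    (f := fun u => lqnorm (B (of_row u))).
  by apply: continuous_subspaceT => u; exact: (row_operator_continuous linB BC).
exists (of_row v); split => //; first exact: pos_row.
  by move=> k nk; exact: coord_of_row_out.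
move=> x xn.
have [->|/eqP x0] := eqVneq x 0; first by rewrite (op0 linB) !lqnorm_zero mulr0.
have nx0 := lqnorm_gt0 x0.
pose u : 'rV[R]_n.+1 := \row_j normc (coord x j).
have uE : of_row u = abs_lq x.
  apply: coordP => k; rewrite coord_abs; have [kn|nk] := ltnP k n.+1.
    by rewrite (coord_of_row _ kn) mxE.
  by rewrite coord_of_row_out// xn// normc0.
apply: le_trans (lqnorm_op_abs linB posB x) _.
have nVx0 : 0 < (lqnorm x)^-1 by rewrite invr_gt0.
have /mem_set/vmax : A ((lqnorm x)^-1 *: u).
  split => [j|]; first by rewrite !mxE mulr_ge0// ltW.
  by rewrite of_rowZ lqnorm_scale uE lqnorm_abs normc_real gtr0_norm// mulVf// gt_eqF.
rewrite of_rowZ (opZ linB) lqnorm_scale uE normc_real gtr0_norm//.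
by rewrite mulrC ler_pdivrMr.
Qed.

End norm_attained.

(** * Perturbed shifts *)

Section model.
Context {R : realType} {q : R} {q1 : 1 <= q} (hq : 1 < q).
Local Notation X := (lq q1).
Let exp_gt0 : 0 < q := lq_exp_gt0 (q1 := q1).
#[local] Hint Resolve exp_gt0 : core.
Implicit Types (x y z v : X) (S T : X -> X).

(** The shape of the approximating operators. The rows N, N+1, ... are all
    normed by finitely supported vectors, so they persist in SOT-neighbourhoods;
    the rows beyond 2N are those of the shift by N; row 2N involves the
    coordinate N alone, and each row N + j with j < N ties the coordinate j to
    the coordinate N. The first N rows are left free to carry the operator that
    is being approximated. *)
Definition perturbed_shift N T := [/\ pcontraction T,
  (forall j, exists2 v, finitely_supported v & norms_row T (N + j) v) &
  exists a b : nat -> R[i], [/\ forall j, a j != 0, b N != 0,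
    forall j, (N < j)%N -> a j = 1 /\ b j = 0 &
    forall x j, coord (T x) (N + j)%N =
      (if j == N then 0 else a j * coord x j) + b j * coord x N]].

(** Up to normalisation this is the image of e_N under the perturbed shift, which
    has to meet every row from N to 2N. *)
Lemma block_vector N : exists g : X, [/\ positive_vector g, lqnorm g = 1 &
  forall n, (coord g n != 0) = (N <= n <= N + N)%N].
Proof.
pose s : X := rshift N (\sum_(i < N.+1) basis i).
have sE n : coord s n = (N <= n <= N + N)%N%:R.
  rewrite coord_rshift coord_sum; case: (ltnP n N) => //= Nn.
  rewrite -leq_subLR; under eq_bigr do rewrite coord_basis.
  have [nN|nN] := leqP (n - N) N.
    rewrite (bigD1 (Ordinal (nN : (n - N < N.+1)%N)))//= eqxx big1 ?addr0// => i.
    by rewrite -val_eqE/= eq_sym => /negbTE ->.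
  rewrite big1// => i _; case: eqP => // niN.
  by move: nN; rewrite niN ltnNge -ltnS ltn_ord.
have s0 : 0 < lqnorm s.
  apply: lqnorm_gt0 => /(congr1 (fun z => coord z N)).
  by rewrite sE leqnn leq_addr coord0 => /eqP; rewrite oner_eq0.
have sV0 : 0 < (lqnorm s)^-1 by rewrite invr_gt0.
exists ((lqnorm s)^-1%:C *: s); split.
- apply: positive_vectorZ; first exact: ltW.
  by move=> n; rewrite sE ler0n.
- by rewrite lqnorm_scale normc_real gtr0_norm// mulVf// gt_eqF.
move=> n; rewrite coordZ sE mulf_eq0 negb_or fmorph_eq0 gt_eqF//=.
by case: (_ && _); rewrite ?oner_eq0 ?eqxx.
Qed.

Context (T0 : X -> X) (cT0 : pcontraction T0) (N : nat).
Context (eta : R) (eta0 : 0 < eta).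
Context (g : X) (g0 : positive_vector g) (g1 : lqnorm g = 1).
Context (gE : forall n, (coord g n != 0) = (N <= n <= N + N)%N).

Let head := restr (q1 := q1) (fun n => n < N)%N.

(** The finite block: T0 compressed to the first N coordinates, a small copy of
    these coordinates in the rows N, ..., 2N - 1, from which they can be
    recovered, and the vector e_N, sent to g, through which these rows become
    norming. *)
Definition block_operator x : X :=
  head (T0 (head x)) + eta%:C *: rshift N (head x) + coord x N *: g.
Local Notation B := block_operator.

Lemma block_linear : linear B.
Proof.
have [linT0 _ _] := cT0.
move=> l x y; rewrite /B /head restr_linear linT0 restr_linear rshift_linear.
by apply: coordP => n; rewrite !(coordD, coordZ); ring.
Qed.

Lemma block_positive : positive_operator B.
Proof.
have [_ posT0 _] := cT0; move=> x x0; apply: positive_vectorD.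
  apply: positive_vectorD; first by apply/restr_positive/posT0/restr_positive.
  by apply: positive_vectorZ; [exact: ltW|apply/rshift_positive/restr_positive].
by move=> n; rewrite coordZ mulr_ge0// ?x0 ?g0.
Qed.

Lemma coord_g_out n : ~~ (N <= n <= N + N)%N -> coord g n = 0.
Proof. by rewrite -gE negbK => /eqP. Qed.

(** Without the term in eta the operator is a contraction, since T0 and g act on
    disjoint coordinates and have disjoint ranges. *)
Lemma block_bound x : lqnorm (B x) <= (1 + eta) * lqnorm x.
Proof.
have [_ _ nT0] := cT0.
rewrite /B addrAC mulrDl mul1r; apply: le_trans (lqnorm_triangle _ _) _.
apply: lerD; last first.
  rewrite lqnorm_scale normc_real gtr0_norm// ler_pM2l//.
  by apply: le_trans (lqnorm_rshift _ _) _; exact: lqnorm_restr.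
rewrite -(ler_powR_base exp_gt0)// lqnormD_disjoint => [|n]; last first.
  rewrite coord_restr coordZ; case: ltnP => nN; [right|by left].
  by rewrite coord_g_out ?mulr0// leqNgt nN.
rewrite lqnorm_scale g1 mulr1 (lqnorm_restr_split (fun n => n < N)%N x).
apply: lerD; rewrite ler_powR_base//.
  exact: le_trans (lqnorm_restr _ _) (nT0 _).
by have := lqnorm_coord (restr (predC (fun n => n < N)%N) x) N;
  rewrite coord_restr/= ltnn.
Qed.

Context (v : X) (v0 : positive_vector v) (v1 : lqnorm v = 1).
Context (vN : forall k, (N < k)%N -> coord v k = 0).
Context (vmax : forall x, (forall k, (N < k)%N -> coord x k = 0) ->
  lqnorm (B x) <= lqnorm (B v) * lqnorm x).

Let beta := lqnorm (B v).

Lemma block_basis : B (basis N) = g.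
Proof.
have [linT0 _ _] := cT0.
have -> : B (basis N) = head (T0 0) + eta%:C *: rshift N 0 + g.
  rewrite /B coord_basis eqxx scale1r.
  rewrite (_ : head (basis N) = 0)//; apply: coordP => n.
  by rewrite coord_restr coord_basis; case: ltnP => // nN; rewrite ltn_eqF.
rewrite /head (op0 linT0) (op0 (@restr_linear _ _ _ _)) (op0 (@rshift_linear _ _ _ _)).
by rewrite scaler0 !add0r.
Qed.

Lemma beta_ge1 : 1 <= beta.
Proof.
rewrite -[leLHS]g1 -block_basis -[leRHS]mulr1 -(lqnorm_basis (q1 := q1) N).
by apply: vmax => k Nk; rewrite coord_basis gtn_eqF.
Qed.

Lemma beta_le : beta <= 1 + eta.
Proof. by have := block_bound v; rewrite v1 mulr1. Qed.

Let beta_gt0 : 0 < beta. Proof. exact: lt_le_trans beta_ge1. Qed.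
Let betaV_gt0 : 0 < beta^-1. Proof. by rewrite invr_gt0. Qed.

(** The block, divided by its norm beta so that it is normed at v, next to the
    shift acting on the coordinates beyond N. *)
Definition model_operator x : X :=
  beta^-1%:C *: B x + rshift N (restr (fun n => N < n)%N x).
Local Notation T := model_operator.

Lemma model_linear : linear T.
Proof.
move=> l x y; rewrite /T block_linear restr_linear rshift_linear.
by apply: coordP => n; rewrite !(coordD, coordZ); ring.
Qed.

Lemma model_positive : positive_operator T.
Proof.
move=> x x0; apply: positive_vectorD.
  by apply: positive_vectorZ; [exact: ltW|exact: block_positive].
by apply/rshift_positive/restr_positive.
Qed.

Lemma coord_block_out x n : (N + N < n)%N -> coord (B x) n = 0.
Proof.
move=> Nn; have nN : (N <= n)%N by rewrite ltnW// (leq_ltn_trans _ Nn)// leq_addr.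
rewrite !coordD !coordZ coord_restr coord_rshift !ltnNge nN/=.
rewrite coord_restr coord_g_out; last by rewrite negb_and -!ltnNge Nn orbT.
by rewrite ltnNge leq_subRL//= ltnW// !mulr0 !addr0.
Qed.

(** The block and the shift act on disjoint coordinates, and their ranges lie in
    [0, 2N] and beyond 2N. *)
Lemma model_bound x : lqnorm (T x) <= lqnorm x.
Proof.
rewrite -(ler_powR_base exp_gt0)// lqnormD_disjoint => [|n]; last first.
  have [nN|Nn] := ltnP (N + N)%N n.
    by left; rewrite coordZ coord_block_out// mulr0.
  right; rewrite coord_rshift; case: ltnP => // Nn'.
  by rewrite coord_restr ltnNge leq_subLR Nn.
rewrite (lqnorm_restr_split (fun n => n <= N)%N x); apply: lerD.
  rewrite ler_powR_base//.
  have -> : B x = B (restr (fun n => n <= N)%N x).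
    rewrite /B coord_restr leqnn; congr (head (T0 _) + _ *: rshift N _ + _);
      by apply: coordP => n; rewrite !coord_restr; case: ltnP => // /ltnW ->.
  rewrite lqnorm_scale normc_real gtr0_norm// ler_pdivrMl//.
  by apply: vmax => k Nk; rewrite coord_restr leqNgt Nk.
rewrite ler_powR_base//; apply: le_trans (lqnorm_rshift _ _) _.
by apply: ler_lqnorm => n; rewrite !coord_restr/= ltnNge.
Qed.

Lemma model_contraction : pcontraction T.
Proof. by split; [exact: model_linear|exact: model_positive|exact: model_bound]. Qed.

Lemma coord_model x j : coord (T x) (N + j)%N =
  (if j == N then 0 else
    (if (j < N)%N then (beta^-1 * eta)%:C else 1) * coord x j) +
  (if (j <= N)%N then beta^-1%:C * coord g (N + j)%N else 0) * coord x N.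
Proof.
rewrite coordD coordZ !coordD !coordZ coord_restr !coord_rshift.
rewrite ltnNge leq_addr/= addKn !coord_restr.
case: ltngtP => jN /=.
- by rewrite addr0 add0r rmorphM mulrDr !mulrA; congr (_ + _); rewrite mulrAC.
- rewrite coord_g_out ?mulr0 ?mul0r ?addr0 ?add0r ?mulr0 ?add0r ?mul1r//.
  by rewrite leq_add2l (leqNgt j N) jN andbF.
- by ring.
Qed.

Lemma model_max : lqnorm (T v) = 1.
Proof.
rewrite /T (_ : restr _ v = 0) ?(op0 (@rshift_linear _ _ _ _)) ?addr0.
  by rewrite lqnorm_scale normc_real gtr0_norm// mulVf// gt_eqF.
by apply: coordP => n; rewrite coord_restr; case: ltnP => // /vN.
Qed.

Lemma model_max_row j : (j <= N)%N -> coord v N != 0 ->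
  coord (T v) (N + j)%N != 0.
Proof.
move=> jN vN0; rewrite coord_model jN.
have gj : 0 < coord g (N + j).
  by rewrite lt_neqAle g0 andbT eq_sym gE leq_addr leq_add2l.
have vNgt : 0 < coord v N by rewrite lt_neqAle v0 andbT eq_sym.
have bV : 0 < beta^-1%:C by rewrite ltcR.
rewrite gt_eqF// ltr_wpDl//; last by rewrite !mulr_gt0.
case: ifP => // jN'; case: ifP => _; last by rewrite mul1r v0.
by rewrite mulr_ge0 ?v0// lecR mulr_ge0// ltW.
Qed.

(** If the coordinate N of the norming vector v vanished, then e_N would be
    disjoint from v although T e_N and T v are both nonzero in some row, and
    moving from v towards e_N would increase the norm by a first order term. *)
Lemma model_max_last : coord v N != 0.
Proof.
apply/eqP => vN0.
have [j jv] : exists j, coord v j != 0.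
  apply: contrapT => /forallNP v_0; suff: lqnorm v = 0 by move/eqP; rewrite v1 oner_eq0.
  by rewrite (_ : v = 0) ?lqnorm_zero//; apply: coordP => n;
     apply/eqP/negPn/negP/v_0.
have jN : (j < N)%N.
  rewrite ltn_neqAle leqNgt; apply/andP; split.
    by apply: contraNneq jv => ->; rewrite vN0.
  by apply: contraNN jv => /vN ->.
set k := (N + j)%N.
have gk : 0 < normc (coord g k).
  rewrite lt_neqAle normc_ge0 andbT eq_sym; apply/eqP => /eq0_normc /eqP.
  by apply/negP; rewrite gE leq_addr leq_add2l ltnW.
have Tvk : 0 < normc (coord (T v) k).
  rewrite lt_neqAle normc_ge0 andbT eq_sym; apply/eqP => /eq0_normc /eqP.
  rewrite coord_model jN ltn_eqF// vN0 mulr0 addr0 mulf_eq0 (negbTE jv) orbF.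
  by rewrite fmorph_eq0 mulf_eq0 !gt_eqF.
pose c := normc (coord (T v) k) `^ (q - 1) * (beta^-1 * normc (coord g k)).
have c0 : 0 < c by rewrite mulr_gt0 ?powR_gt0 ?mulr_gt0.
have TN : T (basis N) = beta^-1%:C *: g.
  rewrite /T block_basis (_ : restr _ _ = 0) ?(op0 (@rshift_linear _ _ _ _)) ?addr0//.
  apply: coordP => n; rewrite coord_restr coord_basis; case: ltnP => // Nn.
  by rewrite gtn_eqF.
have disj : disjoint_lq v (basis N).
  move=> n; rewrite coord_basis; case: eqP => [->|_]; by [left|right].
have bound (t : R) : 0 < t -> c <= t `^ (q - 1) *+ 2.
  move=> t0; have := norming_row_bound k model_contraction v0
    (basis_positive N) disj _ _ (ltW t0).
  rewrite v1 lqnorm_basis => /(_ (lexx _) (lexx _)).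
  rewrite model_max powR1 gerBl powR_ge0 => /(_ isT).
  rewrite TN coordZ normcM normc_real gtr0_norm// mulrCA.
  by rewrite (powR_split _ (ltW t0)) ?gt_eqF// -mulrnAr ler_pM2l.
have := bound ((c / 3) `^ (q - 1)^-1).
rewrite powR_gt0 ?divr_gt0// => /(_ isT).
have c30 : 0 <= c / 3 by rewrite divr_ge0// ltW.
rewrite powRVK ?subr_gt0//; lra.
Qed.

Lemma model_perturbed_shift : perturbed_shift N T.
Proof.
split; first exact: model_contraction.
- move=> j; have [jN|Nj] := leqP j N.
    exists v; first by exists N.+1.
    by split => //; [exact: model_max|apply: model_max_row => //; exact: model_max_last].
  have Tj : T (basis j) = basis (N + j).
    have [linT0 _ _] := cT0.
    have h0 : head (basis j) = 0.
      apply: coordP => n; rewrite coord_restr coord_basis; case: ltnP => // nN.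
      by rewrite ltn_eqF// (ltn_trans nN).
    rewrite /T /B h0 (op0 linT0) (op0 (@rshift_linear _ _ _ _)) coord_basis.
    rewrite ltn_eqF// scaler0 scale0r !addr0 /head (op0 (@restr_linear _ _ _ _)).
    rewrite scaler0 add0r; apply: coordP => n; rewrite coord_rshift coord_restr.
    rewrite !coord_basis; case: ltnP => nN.
      by rewrite ltn_eqF// (leq_trans nN)// leq_addr.
    rewrite -[in RHS](subnKC nN) eqn_add2l; case: ltnP => // nNN.
    by rewrite ltn_eqF// (leq_ltn_trans nNN).
  exists (basis j); first by exists j.+1 => n jn; rewrite coord_basis gtn_eqF.
  split; rewrite ?lqnorm_basis//; first exact: basis_positive.
    by rewrite Tj lqnorm_basis.
  by rewrite Tj coord_basis eqxx oner_eq0.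
exists (fun j => if (j < N)%N then (beta^-1 * eta)%:C else 1).
exists (fun j => if (j <= N)%N then beta^-1%:C * coord g (N + j)%N else 0).
split.
- by move=> j; case: ifP; rewrite ?oner_eq0// fmorph_eq0 mulf_eq0 !gt_eqF.
- by rewrite leqnn mulf_eq0 fmorph_eq0 gt_eqF//= gE leqnn leq_addr.
- by move=> j Nj; rewrite (ltnNge j) (ltnW Nj) (leqNgt j) Nj.
- exact: coord_model.
Qed.

(** Up to the normalisation factor, the model is T0 compressed to the first N
    coordinates plus the small term eta and the part acting on the tail. *)
Lemma model_approx x : lqnorm (T0 x - T x) <=
  lqnorm (restr (fun n => N <= n)%N (T0 x)) +
  lqnorm (restr (fun n => N <= n)%N x) *+ 2 + (eta * lqnorm x) *+ 2.
Proof.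
have [linT0 _ nT0] := cT0.
pose h := head x; pose z := restr (fun n => N <= n)%N x.
have xE : x = h + z by rewrite /h /z -restrB_tail subrKC.
have hx : lqnorm h <= lqnorm x by exact: lqnorm_restr.
have hh : head h = h.
  by apply: coordP => n; rewrite !coord_restr; case: (n < N)%N.
have hN : coord h N = 0 by rewrite coord_restr ltnn.
have tail_h : restr (fun n => N < n)%N h = 0.
  apply: coordP => n; rewrite !coord_restr; case: ltnP => // Nn.
  by rewrite ltnNge ltnW.
have Th : T h = beta^-1%:C *: (head (T0 h) + eta%:C *: rshift N h).
  rewrite /T /B hh hN scale0r addr0 tail_h (op0 (@rshift_linear _ _ _ _)).
  by rewrite addr0.
have -> : T0 x - T x = restr (fun n => N <= n)%N (T0 x) + head (T0 z) +
    (1 - beta^-1)%:C *: head (T0 h) - (beta^-1 * eta)%:C *: rshift N h - T z.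
  rewrite -restrB_tail -/head.
  have -> : head (T0 x) = head (T0 h) + head (T0 z).
    by rewrite [in LHS]xE (opD linT0) /head (opD (@restr_linear _ _ _ _)).
  have -> : T x = T h + T z by rewrite [in LHS]xE (opD model_linear).
  rewrite Th.
  apply: coordP => n; rewrite !(coordD, coordZ, coordN) rmorphB rmorphM rmorph1.
  ring.
have betaV_le1 : beta^-1 <= 1 by rewrite invf_le1// beta_ge1.
have n1 : lqnorm (head (T0 z)) <= lqnorm z.
  exact: le_trans (lqnorm_restr _ _) (nT0 _).
have n2 : lqnorm ((1 - beta^-1)%:C *: head (T0 h)) <= eta * lqnorm x.
  rewrite lqnorm_scale normc_real ger0_norm ?subr_ge0//; apply: ler_pM => //.
  - by rewrite subr_ge0.
  - rewrite lerBlDr -(ler_pM2l beta_gt0) mulrDr mulfV ?gt_eqF// mulr1.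
    apply: le_trans beta_le _; rewrite addrC lerD2r.
    by rewrite ler_peMl// ?beta_ge1// ltW.
  - apply: le_trans hx; exact: le_trans (lqnorm_restr _ _) (nT0 _).
have n3 : lqnorm (- ((beta^-1 * eta)%:C *: rshift N h)) <= eta * lqnorm x.
  rewrite lqnorm_opp lqnorm_scale normc_real gtr0_norm ?mulr_gt0//.
  apply: ler_pM => //; first by rewrite mulr_ge0// ltW.
    by rewrite ler_piMl// ltW.
  exact: le_trans (lqnorm_rshift _ _) hx.
have n4 : lqnorm (- T z) <= lqnorm z by rewrite lqnorm_opp; exact: model_bound.
apply: le_trans (lqnorm_triangle _ _) _.
apply: le_trans (lerD (lqnorm_triangle _ _) n4) _.
apply: le_trans (lerD (lerD (lqnorm_triangle _ _) n3) (lexx _)) _.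
have := lqnorm_triangle (restr (fun n => N <= n)%N (T0 x)) (head (T0 z)).
rewrite -/z; lra.
Qed.

End model.

Lemma perturbed_shift_approx {R : realType} {q : R} {q1 : 1 <= q}
    (T0 : lq q1 -> lq q1) (N : nat) (eta : R) : 1 < q -> pcontraction T0 -> 0 < eta ->
  exists2 T, perturbed_shift N T & forall x, lqnorm (T0 x - T x) <=
    lqnorm (restr (fun n => N <= n)%N (T0 x)) +
    lqnorm (restr (fun n => N <= n)%N x) *+ 2 + (eta * lqnorm x) *+ 2.
Proof.
move=> hq cT0 eta0; have [g [g0 g1 gE]] := @block_vector R q q1 N.
have [v [v0 v1 vN vmax]] := norm_attained N (block_linear cT0 N eta g)
  (block_positive cT0 N eta0 g0) (block_bound cT0 eta0 g1 gE).
exists (model_operator T0 N eta g v).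
  exact: (model_perturbed_shift hq cT0 eta0 g0 g1 gE v0 v1 vN vmax).
exact: (model_approx cT0 eta0 g1 gE v1 vmax).
Qed.

(** * Eigenvectors near a perturbed shift *)

Section eigenvectors.
Context {R : realType} {q : R} {q1 : 1 <= q} (hq : 1 < q).
Local Notation X := (lq q1).
Local Notation P1X := (@P1 R q q1).
Let exp_gt0 : 0 < q := lq_exp_gt0 (q1 := q1).
#[local] Hint Resolve exp_gt0 : core.
Implicit Types (x y z v : X) (S T : P1X).

Definition bounded_eigenvector (A : X -> X) (M : R) x :=
  (exists l : R[i], A x = l *: x) /\ lqnorm x <= M.

Lemma eigenvector_coord (A : X -> X) M x k : pcontraction A ->
  bounded_eigenvector A M x -> normc (coord (A x) k) <= normc (coord x k).
Proof.
move=> [_ _ nA] [[l Ax] _]; have := nA x; rewrite Ax lqnorm_scale coordZ normcM.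
have [->|/eqP/lqnorm_gt0 x0] := eqVneq x 0; first by rewrite coord0 normc0 mulr0.
by rewrite -ler_pdivlMr// divff ?gt_eqF// => l1; exact: ler_piMl.
Qed.

(** Uniformly over the bounded eigenvectors of the operators near T: this is
    what excludes eigenvectors with a large coordinate k on a whole
    neighbourhood of T. *)
Definition vanishing_coord T (M : R) k := forall e : R, 0 < e ->
  \forall S \near T, forall x, bounded_eigenvector (operator S) M x ->
    normc (coord x k) <= e.

Section perturbed_shift.
Context (T : P1X) (N : nat) (N0 : (0 < N)%N) (M : R).
Context (TN : perturbed_shift N (operator T)).

(** In a norming row T x agrees, up to e, with S x = l x, where |l| <= 1. *)
Lemma eigenvector_row j (e : R) : 0 < e -> \forall S \near T,
  forall x, bounded_eigenvector (operator S) M x ->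
    normc (coord (operator T x) (N + j)) <= normc (coord x (N + j)) + e.
Proof.
move=> e0; have [_ /(_ j)[v vfin vj] _] := TN.
near=> S => x xS.
have := ler_normcB (coord (operator T x) (N + j)) (coord (operator S x) (N + j)).
move=> /le_trans; apply; rewrite addrC; apply: lerD.
  exact: eigenvector_coord (operator_contraction S) xS.
rewrite normcB; have [_ xM] := xS; move: x xM {xS}.
by near: S; exact: (norming_row_cvg hq M vfin vj e0).
Unshelve. all: by end_near. Qed.

(** Beyond N the coordinates of an approximate eigenvector cannot decrease along
    the progressions of step N, up to arbitrarily small errors, so that a bound
    on the norm forces them to be small. *)
Lemma vanishing_tail j : (N < j)%N -> vanishing_coord T M j.
Proof.
move=> Nj e e0; have [_ _ [a [b [_ _ ab1 TE]]]] := TN.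
have e2 : 0 < (e / 2) `^ q by rewrite powR_gt0// divr_gt0.
(* If |x_j| > e, then L coordinates are at least e/2, which is too many. *)
pose L := (Num.bound (`|M| `^ q / (e / 2) `^ q)).+1.
have LM : `|M| `^ q < L%:R * (e / 2) `^ q.
  rewrite -ltr_pdivrMr//; apply: lt_trans (archi_boundP _) _.
    by rewrite divr_ge0 ?powR_ge0.
  by rewrite ltr_nat.
pose d := e / 2 / L%:R.
have d0 : 0 < d by rewrite !divr_gt0.
near=> S => x xS; have [_ xM] := xS.
have rows : forall m : 'I_L, forall y, bounded_eigenvector (operator S) M y ->
    normc (coord (operator T y) (N + (j + m * N))) <=
    normc (coord y (N + (j + m * N))) + d.
  by near: S; apply: filter_forall => m; exact: eigenvector_row.
have step (m : 'I_L) : normc (coord x (j + m * N)) <=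
    normc (coord x (j + m.+1 * N)) + d.
  have Njm : (N < j + m * N)%N by rewrite (leq_trans Nj)// leq_addr.
  have [a1 b0] := ab1 _ Njm; have := rows m _ xS.
  by rewrite TE gtn_eqF// a1 b0 mul1r mul0r addr0 mulSn [(N + (j + _))%N]addnCA.
rewrite leNgt; apply/negP => xe.
have chain m : (m <= L)%N -> e - m%:R * d <= normc (coord x (j + m * N)).
  elim: m => [_|m IH mL]; first by rewrite mul0r subr0 mul0n addn0 ltW.
  have := step (Ordinal mL); have := IH (ltnW mL) => /=.
  rewrite -natr1 mulrDl mul1r; lra.
have large m : (m < L)%N -> e / 2 <= normc (coord x (j + m * N)).
  move=> mL; apply: le_trans (chain _ (ltnW mL)).
  have : m%:R * d <= L%:R * d by rewrite ler_pM2r// ler_nat ltnW.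
  have Ld : L%:R * d = e / 2 by rewrite /d mulrCA mulfV ?pnatr_eq0// mulr1.
  by rewrite Ld; lra.
have sum m : (m <= L)%N -> m%:R * (e / 2) `^ q <=
    \sum_(0 <= n < j + m * N) normc (coord x n) `^ q.
  elim: m => [_|m IH mL].
    by rewrite mul0r sumr_ge0// => *; exact: powR_ge0.
  have le1 : (j + m * N < j + m.+1 * N)%N.
    by rewrite ltn_add2l mulSn -[ltnLHS]add0n ltn_add2r.
  rewrite (big_cat_nat (n := j + m * N))//=; last exact: ltnW.
  rewrite -natr1 mulrDl mul1r; apply: lerD; first exact/IH/ltnW.
  rewrite big_ltn// ler_wpDr//; first by apply: sumr_ge0 => *; exact: powR_ge0.
  by rewrite ler_powR_base//; [exact: large|rewrite ltW// divr_gt0].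
have := le_trans (sum L (leqnn _)) (lqnorm_partial x _).
rewrite leNgt => /negP; apply; apply: le_lt_trans LM.
by rewrite ler_powR_base// (le_trans xM)// ler_norm.
Unshelve. all: by end_near. Qed.

(** The coordinate 2N lies in the shifted part and controls the coordinate N
    through row 2N; then row N + k controls the coordinate k < N. *)
Lemma vanishing_all k : vanishing_coord T M k.
Proof.
have [_ _ [a [b [a0 bN0 _ TE]]]] := TN.
have normc_gt0 (w : R[i]) : w != 0 -> 0 < normc w.
  move=> w0; rewrite lt_neqAle normc_ge0 andbT eq_sym.
  by apply: contraNneq w0 => /eq0_normc ->.
have vN : vanishing_coord T M N.
  move=> e e0; set c := normc (b N).
  have c0 : 0 < c by exact: normc_gt0.
  have e20 : 0 < c * e / 2 by rewrite divr_gt0// mulr_gt0.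
  have NN : (N < N + N)%N by rewrite -[ltnLHS]addn0 ltn_add2l.
  near=> S => x xS.
  have r1 : normc (coord (operator T x) (N + N)) <=
      normc (coord x (N + N)) + c * e / 2.
    by move: x xS; near: S; exact: eigenvector_row.
  have r2 : normc (coord x (N + N)) <= c * e / 2.
    by move: x xS {r1}; near: S; exact: vanishing_tail.
  move: r1; rewrite TE eqxx add0r normcM -/c => r1.
  rewrite -(ler_pM2l c0); lra.
have [kN|Nk|->//] := ltngtP k N; last exact: vanishing_tail.
have vNk : vanishing_coord T M (N + k).
  have [->|k0] := eqVneq k 0%N; first by rewrite addn0.
  by apply: vanishing_tail; rewrite -[ltnLHS]addn0 ltn_add2l lt0n.
move=> e e0; set c := normc (a k).
have c0 : 0 < c by exact: normc_gt0.
have ce0 : 0 < c * e / 3 by rewrite divr_gt0// mulr_gt0.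
have b0 : 0 < normc (b k) + 1 by rewrite ltr_wpDl.
have cbe0 : 0 < c * e / 3 / (normc (b k) + 1) by rewrite divr_gt0.
near=> S => x xS.
have r1 : normc (coord (operator T x) (N + k)) <=
    normc (coord x (N + k)) + c * e / 3.
  by move: x xS; near: S; exact: eigenvector_row.
have r2 : normc (coord x (N + k)) <= c * e / 3.
  by move: x xS {r1}; near: S; exact: vNk.
have r3 : normc (coord x N) <= c * e / 3 / (normc (b k) + 1).
  by move: x xS {r1 r2}; near: S; exact: vN.
have r4 : normc (b k * coord x N) <= c * e / 3.
  rewrite normcM; apply: (@le_trans _ _ ((normc (b k) + 1) * normc (coord x N))).
    by apply: ler_wpM2r => //; rewrite lerDl.
  by rewrite -ler_pdivlMl// mulrC.
rewrite -(ler_pM2l c0); have := ler_normcB (a k * coord x k) (- (b k * coord x N)).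
rewrite opprK normcN normcM -/c.
have -> : a k * coord x k + b k * coord x N = coord (operator T x) (N + k).
  by rewrite TE ltn_eqF.
lra.
Unshelve. all: by end_near. Qed.

End perturbed_shift.
End eigenvectors.

(** * Density and the comeager set *)

Section typical.
Context {R : realType} {q : R} {q1 : 1 <= q} (hq : 1 < q).
Local Notation X := (lq q1).
Local Notation P1X := (@P1 R q q1).

Definition large_eigenvector (n : nat) : set P1X := [set S |
  exists2 x, bounded_eigenvector (operator S) n%:R x &
    exists2 k, (k <= n)%N & n.+1%:R^-1 <= normc (coord x k)].

Lemma eigenvalue_large_eigenvector (S : P1X) :
  (exists l, is_eigenvalue (operator S) l) -> exists n, large_eigenvector n S.
Proof.
move=> [l [x x0 Sx]].
have [k xk] : exists k, coord x k != 0.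
  apply: contrapT => /forallNP x_0; apply: x0; apply: coordP => k.
  by apply/eqP/negPn/negP/x_0.
have xk0 : 0 < normc (coord x k).
  rewrite lt_neqAle normc_ge0 andbT eq_sym.
  by apply: contraNneq xk => /eq0_normc ->.
pose n := maxn k (maxn (Num.bound (lqnorm x)) (Num.bound (normc (coord x k))^-1)).
exists n, x.
  split; first by exists l.
  apply: ltW; apply: lt_le_trans (archi_boundP (lqnorm_ge0 x)) _.
  by rewrite ler_nat /n leq_max leq_maxl orbT.
exists k; first exact: leq_maxl.
rewrite invf_ple ?posrE//; apply: ltW.
apply: lt_le_trans (archi_boundP _) _; first by rewrite invr_ge0.
by rewrite ler_nat /n leqW// !leq_max leqnn !orbT.
Qed.

Lemma perturbed_shift_interior (T : P1X) N n : (0 < N)%N ->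
  perturbed_shift N (operator T) -> (~` large_eigenvector n)° T.
Proof.
move=> N0 TN; have n0 : 0 < n.+1%:R^-1 / 2 :> R by rewrite divr_gt0// invr_gt0.
rewrite /interior/=; near=> S => -[x xS [k kn xk]].
have small : forall (k : 'I_n.+1) y, bounded_eigenvector (operator S) n%:R y ->
    normc (coord y k) <= n.+1%:R^-1 / 2.
  near: S; apply: filter_forall => i.
  exact: (vanishing_all hq N0 n%:R TN i n0).
have := small (Ordinal (kn : (k < n.+1)%N)) _ xS.
move=> /(le_trans xk); rewrite leNgt => /negP; apply.
by rewrite ltr_pdivrMr// ltr_pMr ?ltr1n// invr_gt0.
Unshelve. all: by end_near. Qed.

(** With eta = 1/N, the two tails in perturbed_shift_approx tend to 0 at every
    vector as N grows. *)
Lemma perturbed_shift_sequence (T0 : P1X) : exists T : nat -> P1X,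
  (forall n, perturbed_shift n.+1 (operator (T n))) /\ T @ \oo --> T0.
Proof.
have approx n : exists T : P1X, perturbed_shift n.+1 (operator T) /\
    forall x, lqnorm (operator T0 x - operator T x) <=
      lqnorm (restr (fun i => n.+1 <= i)%N (operator T0 x)) +
      lqnorm (restr (fun i => n.+1 <= i)%N x) *+ 2 + (n.+1%:R^-1 * lqnorm x) *+ 2.
  have n0 : 0 < n.+1%:R^-1 :> R by rewrite invr_gt0.
  have [T TN TT0] := perturbed_shift_approx n.+1 hq (operator_contraction T0) n0.
  have TP : (T : {ptws X -> X}) \in P1X.
    by apply/mem_set/P1P; have [] := TN.
  by exists (exist _ T TP).
have [T TP] := choice approx; exists T; split => [n|]; first by have [] := TP n.
apply: (cvg_SOT T0 _).2 => x; apply/cvgr0Pnorm_lt => e e0.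
have e8 : 0 < e / 8 by rewrite divr_gt0.
have [n1 _ tail1] := restr_tail_small (operator T0 x) e8.
have [n2 _ tail2] := restr_tail_small x e8.
have x8 : 0 < e / 8 / (lqnorm x + 1) by rewrite divr_gt0// ltr_wpDl.
exists (maxn n1 (maxn n2 (Num.bound (e / 8 / (lqnorm x + 1))^-1))) => // n.
rewrite /= !geq_max => /and3P[n1n n2n nn].
have [_ /(_ x) TnT0] := TP n.
rewrite ger0_norm//; apply: le_lt_trans TnT0 _.
have {tail1} t1 : lqnorm (restr (fun i => n.+1 <= i)%N (operator T0 x)) < e / 8.
  exact: tail1 (leqW n1n).
have {tail2} t2 : lqnorm (restr (fun i => n.+1 <= i)%N x) < e / 8.
  exact: tail2 (leqW n2n).
have t3 : n.+1%:R^-1 * lqnorm x <= e / 8.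
  have : n.+1%:R^-1 <= e / 8 / (lqnorm x + 1).
    rewrite invf_ple ?posrE//; apply: ltW; apply: lt_le_trans (archi_boundP _) _.
      by rewrite invr_ge0 ltW.
    by rewrite ler_nat leqW.
  rewrite ler_pdivlMr ?ltr_wpDl//; apply: le_trans.
  by rewrite ler_pM2l ?invr_gt0// lerDl.
apply: (@le_lt_trans _ _ (e / 8 + (e / 8) *+ 2 + (e / 8) *+ 2)); last by lra.
apply: lerD; last by rewrite lerMn2r.
by apply: lerD; [exact: ltW|rewrite lerMn2r ltW].
Qed.

(** Every perturbed shift belongs to all the interiors, so that the G_delta set
    inherits the density of the perturbed shifts. *)
Lemma typical_no_eigenvalue :
  typical (fun T : X -> X => ~ exists l : R[i], is_eigenvalue T l).
Proof.
exists (\bigcap_n (~` large_eigenvector n)°); split.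
- by exists (fun n => (~` large_eigenvector n)°) => // n; exact: open_interior.
- move=> O [T0 OT0] oO; have [T [TN TT0]] := perturbed_shift_sequence T0.
  have [n _ /(_ n (leqnn n)) OT] := TT0 O (open_nbhs_nbhs (conj oO OT0)).
  by exists (T n); split => // m _; exact: perturbed_shift_interior (TN n).
- move=> S SG /eigenvalue_large_eigenvector[n].
  exact: (interior_subset (SG n I)).
Qed.

End typical.

Theorem corollary3p4 (R : realType) (q : R) (hq : 2 < q) :
  typical (fun T : lq (gt2_ge1 hq) -> lq (gt2_ge1 hq) =>
    ~ exists l : R[i], is_eigenvalue T l).
Proof. by apply: typical_no_eigenvalue; rewrite (lt_trans _ hq)// ltr1n. Qed.
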